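(* Let $\alpha,\beta>0$, $n\ge1$, and let $S_n(z;\alpha,\beta)=z\frac{d}{dz}\ln\Delta_n(z;\alpha,\beta)$ with $\Delta_n(z;\alpha,\beta)=\mathcal{W}_n\big(M(\alpha,\beta,z)\big)$. Then $S=S_n$ satisfies $$\Big(z\frac{d^2S}{dz^2}\Big)^2=\Big[(z+n+\beta-1)\frac{dS}{dz}-S-\tfrac12 n(n-1+2\alpha)\Big]^2-4\frac{dS}{dz}\Big(\frac{dS}{dz}-n-\alpha+\beta\Big)\Big[z\frac{dS}{dz}-S+\tfrac12n(n-1)\Big].$$
   Context: $M(\alpha,\beta,z)$ is the Kummer function ${}_1F_1(\alpha;\beta;z)$; $\delta_z= z\,\frac{d}{dz}$; for smooth $\psi$, $\mathcal{W}_n(\psi)=\det[\delta_z^{\,j+k}\psi]_{j,k=0}^{n-1}$. (This $\Delta_n$ is the Hankel determinant of moments of the weight $(\alpha)_kz^k/((\beta)_k k!)$ on $\mathbb{N}$.) *)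

(* Defs.v *)
From Stdlib Require Import Reals Lra ClassicalEpsilon Arith Factorial.
Open Scope R_scope.

Definition Deriv (f : R -> R) (x : R) : R :=
  epsilon (inhabits 0) (fun l => derivable_pt_lim f x l).

Definition delta (f : R -> R) : R -> R := fun z => z * Deriv f z.

Fixpoint poch (a : R) (k : nat) : R :=
  match k with O => 1 | S k' => poch a k' * (a + INR k') end.

Definition kummer_coef (a b : R) (k : nat) : R :=
  poch a k / (poch b k * INR (fact k)).

Definition KummerM (a b z : R) : R :=
  epsilon (inhabits 0) (fun l => infinite_sum (fun k => kummer_coef a b k * z ^ k) l).

Fixpoint detn (n : nat) (A : nat -> nat -> R) : R :=
  match n with
  | O => 1
  | S m => sum_f_R0 (fun j => (-1) ^ j * A O j *
             detn m (fun i k => A (S i) (if Nat.ltb k j then k else S k))) m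
  end.

Definition Wn (n : nat) (psi : R -> R) (z : R) : R :=
  detn n (fun j k => Nat.iter (j + k) delta psi z).

Definition Delta_n (n : nat) (a b : R) : R -> R := Wn n (KummerM a b).

(* S_n = z d/dz ln Delta_n = z Delta_n' / Delta_n *)
Definition Sn (n : nat) (a b : R) : R -> R :=
  fun z => z * Deriv (Delta_n n a b) z / Delta_n n a b z.

(* Main.v *)
(** Gaussian elimination on the Hankel matrix [delta^(j+k) M] gives pivots [h_m]
    with [Delta_n = h_0 ... h_(n-1)].  The derivation [delta] acts on the entries by
    an index shift, and this yields the Toda equations
    [delta S_n = a_n], [delta a_n = a_n (b_n - b_(n-1))], [delta b_n = a_(n+1) - a_n],
    where [a_n = h_n / h_(n-1)] and [b_n = S_(n+1) - S_n].  Together with the Kummer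
    equation, which is [relation3] for [n = 0], they propagate two Laguerre-Freud
    relations from [n] to [n + 1]: [relation1] at [n + 1] is the [delta]-derivative of
    [relation3] at [n], and [relation3] at [n + 1] comes from the [delta]-derivative of
    [relation1] at [n + 1], divided by [a_(n+1)].  A third relation follows
    by pure algebra; eliminating [b_n] and [b_(n-1)] gives the sigma form.

    The divisions are legitimate on some interval [(0, eps)].  Indeed, if
    [Delta_(m+1)] is the last determinant that is not identically zero, then
    [relation3] at [m] forces [S_(m+1)] to be a negative constant [-N], that is
    [delta Delta_(m+1) = - N Delta_(m+1)], and no nonzero power series solves this.
    After clearing denominators the sigma form is an identity between entire
    functions, hence extends from [(0, eps)] to the whole real line. *)

Require Import Defs.
From Stdlib Require Import Reals Lra Lia Arith Classical ClassicalEpsilon.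
From mathcomp Require all_boot all_algebra Rstruct.
From Coquelicot Require Import Coquelicot.
Open Scope R_scope.

(** * Determinants by Gaussian elimination *)

Module DeterminantElimination.
Import all_boot all_algebra Rstruct.
Set Implicit Arguments. Unset Strict Implicit. Unset Printing Implicit Defensive.
Import GRing.Theory.
Local Open Scope ring_scope.

Lemma sum_f_R0_big (F : nat -> R) (m : nat) :
  sum_f_R0 F m = \sum_(j < m.+1) F j.
Proof.
elim: m => [|m IH] /=; first by rewrite big_ord1.
by rewrite big_ord_recr /= IH.
Qed.

(** [detn] is Laplace expansion along row 0, and its column skip is [bump]. The bridge to [\det]
    gives access to block factorizations. *)
Lemma detn_det (n : nat) (A : nat -> nat -> R) :
  detn n A = \det (\matrix_(i < n, j < n) A i j).
Proof.
elim: n A => [|n IH] A; first by rewrite det_mx00.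
rewrite (expand_det_row _ ord0) [LHS]/= sum_f_R0_big; apply: eq_bigr => j _.
rewrite IH /cofactor !mxE add0n !RmultE RpowE mulrA; congr (_ * _).
  by rewrite mulrC.
congr (\det _); apply/matrixP => i k; rewrite !mxE /= /bump /=.
case: Nat.ltb_spec => /=.
  by move/ltP; rewrite ltnNge => /negbTE ->.
by move/leP => ->.
Qed.

(** Block LU factorization: the left factor is unit lower triangular with the elimination
    multipliers [v] as first column, and the right factor is block upper triangular with the Schur
    complement [B] of the corner entry. *)
Lemma detn_elim (m : nat) (A : nat -> nat -> R) : A 0%N 0%N <> 0 ->
  detn m.+1 A =
  A 0%N 0%N * detn m (fun i j => A i.+1 j.+1 - A i.+1 0%N * A 0%N j.+1 / A 0%N 0%N).
Proof.
move=> /eqP A00; rewrite !detn_det.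
set M := (X in \det X = _).
pose M' : 'M[R]_(1 + m) := M.
pose v : 'cV[R]_m := \col_i (A i.+1 0%N / A 0%N 0%N).
pose u : 'rV[R]_m := \row_j A 0%N j.+1.
pose B : 'M[R]_m := \matrix_(i, j) (A i.+1 j.+1 - A i.+1 0%N * A 0%N j.+1 / A 0%N 0%N).
have -> : M = block_mx 1%:M 0 v 1%:M *m block_mx (A 0%N 0%N)%:M u 0 B :> 'M_(1 + m).
  rewrite mulmx_block !mul1mx !mul0mx !addr0 -[M]/M' -[M']submxK.
  congr block_mx; apply/matrixP => i j; rewrite !mxE /= ?big_ord1 ?mxE.
  - by rewrite !ord1.
  - by rewrite !ord1.
  - by rewrite !ord1 /= divfK.
  - by rewrite addrC mulrAC subrK.
by rewrite det_mulmx (det_lblock 1%:M v 1%:M) (det_ublock _ u B) !det1 !mul1r det_scalar1.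
Qed.
End DeterminantElimination.

(** The Schur complement of the corner entry, taken on an infinite array so that iterating it does
    not depend on the size of a matrix. *)
Definition elim (A : nat -> nat -> R) : nat -> nat -> R :=
  fun i j => A (S i) (S j) - A (S i) O * A O (S j) / A O O.

Lemma detn_elim (m : nat) (A : nat -> nat -> R) :
  A O O <> 0 -> detn (S m) A = A O O * detn m (elim A).
Proof. exact (@DeterminantElimination.detn_elim m A). Qed.

(** * Entire functions on the real line *)

(** The coefficients stay visible because the Kummer equation and the nonvanishing of the pivots are
    proved by comparing them. *)
Definition expands (a : nat -> R) (f : R -> R) : Prop :=
  CV_radius a = p_infty /\ forall x, f x = PSeries a x.

Definition entire (f : R -> R) : Prop := exists a, expands a f.

(** Beyond a finite radius [r], say at [r + 1], the terms would not tend to 0, against convergence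
    there. *)
Lemma infinite_CV_radius (a : nat -> R) :
  (forall x, ex_pseries a x) -> CV_radius a = p_infty.
Proof.
intros H.
destruct (CV_radius a) as [r| |] eqn:E; [exfalso|reflexivity|exfalso].
- assert (Hr : 0 <= r).
  { generalize (CV_radius_ge_0 a). rewrite E. easy. }
  apply (CV_disk_outside a (r + 1)).
  + rewrite E. simpl. rewrite Rabs_pos_eq; lra.
  + apply ex_series_lim_0.
    apply (ex_series_ext (fun k => scal (pow_n (r + 1) k) (a k))); [|apply H].
    intros k. rewrite pow_n_pow. apply Rmult_comm.
- generalize (CV_radius_ge_0 a). rewrite E. easy.
Qed.

Lemma expands_inside (a : nat -> R) (f : R -> R) (x : R) :
  expands a f -> Rbar_lt (Rabs x) (CV_radius a).
Proof. intros [H _]. now rewrite H. Qed.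

Lemma expands_pseries (a : nat -> R) (f : R -> R) (x : R) :
  expands a f -> is_pseries a x (f x).
Proof.
intros H. rewrite (proj2 H x). apply PSeries_correct, CV_radius_inside.
now apply (expands_inside a f).
Qed.

Lemma expands_intro (a : nat -> R) (f : R -> R) :
  (forall x, is_pseries a x (f x)) -> expands a f.
Proof.
intros H. split.
- apply infinite_CV_radius. intros x. eexists. apply H.
- intros x. symmetry. now apply is_pseries_unique.
Qed.

Lemma expands_plus (a b : nat -> R) (f g : R -> R) :
  expands a f -> expands b g -> expands (PS_plus a b) (fun x => f x + g x).
Proof.
intros Hf Hg. apply expands_intro. intros x.
apply (is_pseries_plus a b); now apply expands_pseries.
Qed.

Lemma expands_mult (a b : nat -> R) (f g : R -> R) :
  expands a f -> expands b g -> expands (PS_mult a b) (fun x => f x * g x).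
Proof.
intros Hf Hg. apply expands_intro. intros x.
apply is_pseries_mult; try (now apply expands_pseries).
- now apply (expands_inside a f).
- now apply (expands_inside b g).
Qed.

Lemma expands_scal (c : R) (a : nat -> R) (f : R -> R) :
  expands a f -> expands (PS_scal c a) (fun x => c * f x).
Proof.
intros Hf. apply expands_intro. intros x.
apply (is_pseries_scal c a); [apply Rmult_comm|now apply expands_pseries].
Qed.

Lemma expands_incr (a : nat -> R) (f : R -> R) :
  expands a f -> expands (PS_incr_1 a) (fun x => x * f x).
Proof.
intros [H1 H2]. split.
- now rewrite CV_radius_incr_1.
- intros x. rewrite PSeries_incr_1. now rewrite H2.
Qed.

Lemma expands_derive (a : nat -> R) (f : R -> R) :
  expands a f -> forall x, is_derive f x (PSeries (PS_derive a) x).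
Proof.
intros H x.
apply (is_derive_ext (PSeries a)).
- intros t. symmetry. apply H.
- apply is_derive_PSeries. now apply (expands_inside a f).
Qed.

(** Once some derivative exists, [epsilon] picks one, and derivatives are unique. Values of [Deriv]
    are computed through this lemma. *)
Lemma Deriv_unique (f : R -> R) (x l : R) : is_derive f x l -> Deriv f x = l.
Proof.
intros H.
assert (H1 : derivable_pt_lim f x (Deriv f x)).
{ unfold Deriv. apply epsilon_spec. exists l. now apply is_derive_Reals. }
apply is_derive_Reals in H1.
rewrite <- (is_derive_unique _ _ _ H). symmetry. now apply is_derive_unique.
Qed.

Lemma entire_const (c : R) : entire (fun _ => c).
Proof.
exists (fun k => match k with O => c | _ => 0 end). apply expands_intro. intros x.
apply (is_series_ext (fun k => match k with O => c | _ => 0 end)).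
{ intros [|k]; [simpl; unfold scal, one; simpl; unfold mult; simpl; ring|].
  symmetry. apply (scal_zero_r (V := R_NormedModule)). }
assert (Hs : forall n, sum_f_R0 (fun k => match k with O => c | _ => 0 end) n = c).
{ induction n as [|n IH]; simpl; [reflexivity|]. rewrite IH. ring. }
apply is_series_Reals. intros e He. exists O. intros n _.
rewrite Hs. unfold Rdist. rewrite Rminus_diag. now rewrite Rabs_R0.
Qed.

Lemma entire_plus (f g : R -> R) :
  entire f -> entire g -> entire (fun x => f x + g x).
Proof. intros [a Ha] [b Hb]. eexists. now apply expands_plus; [apply Ha|apply Hb]. Qed.

Lemma entire_mult (f g : R -> R) :
  entire f -> entire g -> entire (fun x => f x * g x).
Proof. intros [a Ha] [b Hb]. eexists. now apply expands_mult; [apply Ha|apply Hb]. Qed.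

Lemma entire_ext (f g : R -> R) :
  (forall x, f x = g x) -> entire f -> entire g.
Proof.
intros E [a [H1 H2]]. exists a. split; [exact H1|]. intros x. now rewrite <- E.
Qed.

Lemma entire_id : entire (fun x => x).
Proof.
destruct (entire_const 1) as [a Ha]. exists (PS_incr_1 a).
apply expands_incr in Ha. destruct Ha as [H1 H2]. split; [exact H1|].
intros x. rewrite <- H2. ring.
Qed.

Lemma entire_opp (f : R -> R) : entire f -> entire (fun x => - f x).
Proof.
intros Hf. apply (entire_ext (fun x => -1 * f x)); [intros x; ring|].
apply entire_mult; [apply entire_const|exact Hf].
Qed.

Lemma entire_minus (f g : R -> R) :
  entire f -> entire g -> entire (fun x => f x - g x).
Proof. intros Hf Hg. apply entire_plus; [exact Hf|now apply entire_opp]. Qed.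

Lemma entire_pow (f : R -> R) (k : nat) : entire f -> entire (fun x => f x ^ k).
Proof.
intros Hf. induction k as [|k IH]; simpl.
- apply entire_const.
- now apply entire_mult.
Qed.

Lemma entire_sum (F : nat -> R -> R) (m : nat) :
  (forall j, entire (F j)) -> entire (fun x => sum_f_R0 (fun j => F j x) m).
Proof.
intros H. induction m as [|m IH]; simpl; [apply H|]. now apply entire_plus.
Qed.

Lemma entire_detn (n : nat) (A : nat -> nat -> R -> R) :
  (forall i j, entire (A i j)) -> entire (fun x => detn n (fun i j => A i j x)).
Proof.
revert A. induction n as [|n IH]; intros A H; simpl.
- apply entire_const.
- apply entire_sum. intros j. apply entire_mult.
  + apply entire_mult; [apply entire_const|apply H].
  + apply (IH (fun i k => A (S i) (if Nat.ltb k j then k else S k))).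
    intros i k. apply H.
Qed.

Lemma entire_is_derive (f : R -> R) (x : R) : entire f -> is_derive f x (Deriv f x).
Proof.
intros [a Ha]. rewrite (Deriv_unique f x (PSeries (PS_derive a) x)).
- now apply expands_derive.
- now apply expands_derive.
Qed.

Lemma expands_Deriv (a : nat -> R) (f : R -> R) :
  expands a f -> expands (PS_derive a) (Deriv f).
Proof.
intros H. split.
- rewrite CV_radius_derive. apply H.
- intros x. apply Deriv_unique. now apply expands_derive.
Qed.

Lemma entire_Deriv (f : R -> R) : entire f -> entire (Deriv f).
Proof. intros [a Ha]. eexists. apply expands_Deriv. apply Ha. Qed.

Lemma expands_delta (a : nat -> R) (f : R -> R) :
  expands a f -> expands (fun k => INR k * a k) (delta f).
Proof.
intros H. apply expands_Deriv, expands_incr in H. destruct H as [H1 H2]. split.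
- rewrite <- H1. apply CV_radius_ext. intros [|k]; simpl.
  + unfold zero; simpl. ring.
  + unfold PS_derive. destruct k; reflexivity.
- intros x. unfold delta. rewrite H2. apply PSeries_ext. intros [|k]; simpl.
  + unfold zero; simpl. ring.
  + unfold PS_derive. destruct k; reflexivity.
Qed.

Lemma entire_delta (f : R -> R) : entire f -> entire (delta f).
Proof. intros [a Ha]. eexists. apply expands_delta. apply Ha. Qed.

(* Factor out the lowest nonvanishing power of x. *)
Lemma entire_nonzero_near_0 (f : R -> R) (z : R) :
  entire f -> f z <> 0 ->
  exists eps : posreal, forall x, 0 < x < eps -> f x <> 0.
Proof.
intros [a Ha] Hz.
destruct (classic (exists k, a k <> 0)) as [H|H].
- destruct (dec_inh_nat_subset_has_unique_least_element (fun k => a k <> 0))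
    as [m [[Hm Hmin] _]].
  { intros k. apply classic. }
  { exact H. }
  assert (Hlow : forall k, (k < m)%nat -> a k = 0).
  { intros k Hk. apply NNPP. intros Hk'. apply Hmin in Hk'. lia. }
  set (g := PSeries (PS_decr_n a m)).
  assert (Hg0 : g 0 <> 0).
  { unfold g. rewrite PSeries_0. unfold PS_decr_n. now rewrite Nat.add_0_r. }
  assert (Hc : continuous g 0).
  { apply continuity_pt_filterlim, PSeries_continuity.
    rewrite infinite_CV_radius; [easy|].
    intros x. apply ex_pseries_decr_n.
    - destruct (Req_dec x 0) as [->|Hx]; [now left|right].
      exists (/ x). now apply Rinv_l.
    - eexists. apply (expands_pseries a f x Ha). }
  assert (Hl : locally 0 (fun x => g x <> 0)).
  { apply (Hc (fun y => y <> 0)). apply (open_neq 0 (g 0) Hg0). }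
  destruct Hl as [eps Heps]. exists eps. intros x Hx.
  rewrite (proj2 Ha x), (PSeries_decr_n_aux a m x Hlow).
  apply Rmult_integral_contrapositive_currified.
  + apply pow_nonzero. lra.
  + apply Heps. change (Rabs (x - 0) < eps). rewrite Rabs_pos_eq; lra.
- exfalso. apply Hz. rewrite (proj2 Ha z).
  rewrite (PSeries_ext a (fun _ => 0)).
  + apply PSeries_const_0.
  + intros k. apply NNPP. intros Hk. apply H. now exists k.
Qed.

(** The identity theorem: otherwise [f] would have no zero on some interval to the right of 0, which
    meets [(0, eps)]. *)
Lemma entire_eq0 (f : R -> R) (eps : posreal) (z : R) :
  entire f -> (forall x, 0 < x < eps -> f x = 0) -> f z = 0.
Proof.
intros Hf H. apply NNPP. intros Hz.
destruct (entire_nonzero_near_0 f z Hf Hz) as [eps' H'].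
generalize (cond_pos eps) (cond_pos eps'). intros H1 H2.
pose (x := Rmin eps eps' / 2).
assert (Hx : 0 < Rmin eps eps') by now apply Rmin_pos.
generalize (Rmin_l eps eps') (Rmin_r eps eps'). intros H3 H4.
apply (H' x); [unfold x; lra|]. apply H. unfold x; lra.
Qed.

(** * Toda equations *)

(* Division by [x] makes this [x f'(x) = l] for [x <> 0]. *)
Definition is_delta (f : R -> R) (x l : R) : Prop := is_derive f x (l / x).

Lemma is_delta_eq (f : R -> R) (x l l' : R) : is_delta f x l -> l = l' -> is_delta f x l'.
Proof. now intros H <-. Qed.

Lemma is_delta_const (c x : R) : is_delta (fun _ => c) x 0.
Proof.
unfold is_delta. replace (0 / x) with 0 by (unfold Rdiv; ring).
apply (is_derive_const (V := R_NormedModule)).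
Qed.

Lemma is_delta_id (x : R) : x <> 0 -> is_delta (fun t => t) x x.
Proof.
intros Hx. unfold is_delta. replace (x / x) with 1 by (field; exact Hx).
apply (is_derive_id (K := R_AbsRing)).
Qed.

Lemma is_delta_plus (f g : R -> R) (x l m : R) :
  is_delta f x l -> is_delta g x m -> is_delta (fun t => f t + g t) x (l + m).
Proof.
intros Hf Hg. unfold is_delta. replace ((l + m) / x) with (l / x + m / x) by (unfold Rdiv; ring).
now apply (is_derive_plus (V := R_NormedModule)).
Qed.

Lemma is_delta_minus (f g : R -> R) (x l m : R) :
  is_delta f x l -> is_delta g x m -> is_delta (fun t => f t - g t) x (l - m).
Proof.
intros Hf Hg. unfold is_delta. replace ((l - m) / x) with (l / x - m / x) by (unfold Rdiv; ring).
now apply (is_derive_minus (V := R_NormedModule)).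
Qed.

Lemma is_delta_mult (f g : R -> R) (x l m : R) :
  is_delta f x l -> is_delta g x m ->
  is_delta (fun t => f t * g t) x (l * g x + f x * m).
Proof.
intros Hf Hg. unfold is_delta.
replace ((l * g x + f x * m) / x) with (l / x * g x + f x * (m / x)) by (unfold Rdiv; ring).
apply (is_derive_mult (K := R_AbsRing)); try assumption. intros; apply Rmult_comm.
Qed.

Lemma is_delta_div (f g : R -> R) (x l m : R) :
  g x <> 0 -> is_delta f x l -> is_delta g x m ->
  is_delta (fun t => f t / g t) x (l / g x - f x * m / (g x * g x)).
Proof.
intros H Hf Hg. unfold is_delta.
replace ((l / g x - f x * m / (g x * g x)) / x)
  with ((l / x * g x - f x * (m / x)) / g x ^ 2).
- now apply is_derive_div.
- unfold Rdiv. set (y := / x). field. exact H.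
Qed.

Lemma is_delta_unique (f : R -> R) (x l m : R) :
  x <> 0 -> is_delta f x l -> is_delta f x m -> l = m.
Proof.
intros Hx Hl Hm.
assert (H : l / x = m / x).
{ rewrite <- (is_derive_unique _ _ _ Hl). now apply is_derive_unique. }
apply (Rmult_eq_reg_r (/ x)); [exact H|now apply Rinv_neq_0_compat].
Qed.

(** This is the tool for differentiating a relation: it must hold on an interval, not only at
    [x]. *)
Lemma is_delta_congr (f g : R -> R) (eps x l m : R) :
  0 < x < eps -> (forall t, 0 < t < eps -> f t = g t) ->
  is_delta f x l -> is_delta g x m -> l = m.
Proof.
intros Hx H Hf Hg. apply (is_delta_unique g x); [lra| |exact Hg].
apply (is_derive_ext_loc f); [|exact Hf].
apply (locally_interval _ x 0 eps); simpl; try lra.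
intros t Ht1 Ht2. apply H. simpl in *. lra.
Qed.

Definition iter_elim (mu : nat -> R -> R) (m i j : nat) (x : R) : R :=
  Nat.iter m elim (fun i j => mu (i + j)%nat x) i j.

(* [Sig m] is [delta (ln Delta_m)]; [bcoef m] and [acoef m] are the recurrence
   coefficients of the monic orthogonal polynomials of the moments [mu]. *)
Definition pivot (mu : nat -> R -> R) (m : nat) (x : R) : R := iter_elim mu m O O x.
(** For [m = k + 1], the multiplier of the pivot row when elimination step [k] clears row
    [i + 1]. *)
Definition rowcoef (mu : nat -> R -> R) (m i : nat) (x : R) : R :=
  match m with O => 0 | S k => iter_elim mu k (S i) O x / pivot mu k x end.
Definition Sig (mu : nat -> R -> R) (m : nat) (x : R) : R := rowcoef mu m O x.
Definition bcoef (mu : nat -> R -> R) (m : nat) (x : R) : R := Sig mu (S m) x - Sig mu m x.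
Definition acoef (mu : nat -> R -> R) (m : nat) (x : R) : R :=
  match m with O => 0 | S k => pivot mu (S k) x / pivot mu k x end.

Lemma iter_elim_S (mu : nat -> R -> R) (m i j : nat) (x : R) :
  iter_elim mu (S m) i j x =
  iter_elim mu m (S i) (S j) x -
  iter_elim mu m (S i) O x * iter_elim mu m O (S j) x / pivot mu m x.
Proof. reflexivity. Qed.

Lemma iter_elim_sym (mu : nat -> R -> R) (m i j : nat) (x : R) :
  iter_elim mu m i j x = iter_elim mu m j i x.
Proof.
revert i j. induction m as [|m IH]; intros i j.
- unfold iter_elim; simpl. now rewrite Nat.add_comm.
- rewrite !iter_elim_S, (IH (S i) (S j)), (IH (S i) O), (IH O (S j)).
  unfold Rdiv. ring.
Qed.

(** On the moments [delta] shifts the row index. In the induction step the old [rowcoef] corrections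
    cancel in the quotient rule, and differentiating the pivot row produces the new one. *)
Lemma is_delta_iter_elim (mu : nat -> R -> R) (m i j : nat) (x : R) :
  (forall k, is_delta (mu k) x (mu (S k) x)) ->
  (forall k, (k < m)%nat -> pivot mu k x <> 0) ->
  is_delta (iter_elim mu m i j) x
    (iter_elim mu m (S i) j x - rowcoef mu m i x * iter_elim mu m O j x).
Proof.
intros Hmu. revert i j. induction m as [|m IH]; intros i j Hh.
- apply (is_delta_eq _ _ (mu (S i + j)%nat x)).
  + apply Hmu.
  + unfold iter_elim; simpl. ring.
- assert (Hm : pivot mu m x <> 0) by (apply Hh; lia).
  assert (IH' : forall i j, is_delta (iter_elim mu m i j) x
    (iter_elim mu m (S i) j x - rowcoef mu m i x * iter_elim mu m O j x)).
  { intros i' j'. apply IH. intros k Hk. apply Hh. lia. }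
  eapply is_delta_eq.
  + apply is_delta_minus; [apply IH'|].
    apply (is_delta_div (fun t => iter_elim mu m (S i) O t * iter_elim mu m O (S j) t) (pivot mu m)).
    * exact Hm.
    * apply is_delta_mult; apply IH'.
    * apply IH'.
  + rewrite !iter_elim_S. simpl rowcoef. fold (pivot mu m x). field. exact Hm.
Qed.

Lemma is_delta_pivot (mu : nat -> R -> R) (m : nat) (x : R) :
  (forall k, is_delta (mu k) x (mu (S k) x)) ->
  (forall k, (k <= m)%nat -> pivot mu k x <> 0) ->
  is_delta (pivot mu m) x (bcoef mu m x * pivot mu m x).
Proof.
intros Hmu Hh. eapply is_delta_eq.
- apply is_delta_iter_elim; [exact Hmu|]. intros k Hk. apply Hh. lia.
- unfold bcoef, Sig. simpl rowcoef. fold (pivot mu m x). field. now apply Hh.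
Qed.

Lemma is_delta_Sig (mu : nat -> R -> R) (m : nat) (x : R) :
  (forall k, is_delta (mu k) x (mu (S k) x)) ->
  (forall k, (k < m)%nat -> pivot mu k x <> 0) ->
  is_delta (Sig mu m) x (acoef mu m x).
Proof.
intros Hmu Hh. destruct m as [|m].
- apply is_delta_const.
- assert (Hm : pivot mu m x <> 0) by (apply Hh; lia).
  assert (Hh' : forall k, (k < m)%nat -> pivot mu k x <> 0) by (intros k Hk; apply Hh; lia).
  (* By symmetry the 1 moves to the column index. The row shift then creates the entry [(1, 1)],
     whose Schur complement is the next pivot. *)
  apply (is_derive_ext (fun t => iter_elim mu m O 1 t / pivot mu m t)).
  { intros t. unfold Sig. simpl rowcoef. now rewrite iter_elim_sym. }
  change (is_delta (fun t => iter_elim mu m O 1 t / pivot mu m t) x (acoef mu (S m) x)).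
  eapply is_delta_eq.
  + apply is_delta_div; [exact Hm| |]; apply is_delta_iter_elim; assumption.
  + simpl acoef. change (pivot mu (S m) x) with (iter_elim mu (S m) O O x).
    rewrite iter_elim_S, (iter_elim_sym mu m 1 0). fold (pivot mu m x).
    field. exact Hm.
Qed.

Lemma is_delta_bcoef (mu : nat -> R -> R) (m : nat) (x : R) :
  (forall k, is_delta (mu k) x (mu (S k) x)) ->
  (forall k, (k <= m)%nat -> pivot mu k x <> 0) ->
  is_delta (bcoef mu m) x (acoef mu (S m) x - acoef mu m x).
Proof.
intros Hmu Hh. apply is_delta_minus; apply is_delta_Sig; try assumption;
  intros k Hk; apply Hh; lia.
Qed.

Lemma is_delta_acoef (mu : nat -> R -> R) (m : nat) (x : R) :
  (forall k, is_delta (mu k) x (mu (S k) x)) ->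
  (forall k, (k <= m)%nat -> pivot mu k x <> 0) ->
  is_delta (acoef mu m) x (acoef mu m x * (bcoef mu m x - bcoef mu (pred m) x)).
Proof.
intros Hmu Hh. destruct m as [|m].
{ apply (is_delta_eq _ _ 0); [apply is_delta_const|simpl; ring]. }
assert (Hm : pivot mu m x <> 0) by (apply Hh; lia).
eapply is_delta_eq.
- apply is_delta_div; [exact Hm| |]; apply is_delta_pivot; try assumption;
    intros k Hk; apply Hh; lia.
- simpl acoef. simpl pred. field. exact Hm.
Qed.

(** * Laguerre-Freud relations *)

(* [pred 0 = 0] makes [bcoef] junk at [m = 0], where [acoef mu 0 = 0] multiplies it. *)
Definition relation1 (mu : nat -> R -> R) (al be : R) (m : nat) (x : R) : Prop :=
  acoef mu m x * (bcoef mu m x + bcoef mu (pred m) x + be - INR m - x) =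
  x * (Sig mu m x + INR m * (INR m - 1 + 2 * al) / 2).

Definition relation3 (mu : nat -> R -> R) (al be : R) (m : nat) (x : R) : Prop :=
  acoef mu (S m) x + acoef mu m x + bcoef mu m x * bcoef mu m x + (be - 1) * bcoef mu m x
  - INR m * (bcoef mu m x + be - 1) + INR m * (INR m - 1) / 2 - Sig mu m x =
  x * (bcoef mu m x + al + INR m).

Ltac delta_rules :=
  repeat lazymatch goal with
    | |- is_delta (fun _ => ?c) _ _ => apply is_delta_const
    | |- is_delta (fun t => t) _ _ => apply is_delta_id
    | |- is_delta (fun t => @?f t + @?g t) _ _ => apply (is_delta_plus f g)
    | |- is_delta (fun t => @?f t - @?g t) _ _ => apply (is_delta_minus f g)
    | |- is_delta (fun t => @?f t * @?g t) _ _ => apply (is_delta_mult f g)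
    | |- is_delta _ _ _ => eassumption
    end.

(* The derivative [l] is kept abstract because the vanishing pivot case needs [l = 0]
   where [is_delta_acoef] does not apply. *)
Lemma derived_relation3 (mu : nat -> R -> R) (al be eps : R) (m : nat) (l : R -> R) :
  (forall k x, 0 < x < eps -> is_delta (mu k) x (mu (S k) x)) ->
  (forall k x, (k <= m)%nat -> 0 < x < eps -> pivot mu k x <> 0) ->
  (forall x, 0 < x < eps -> is_delta (acoef mu (S m)) x (l x)) ->
  (forall x, 0 < x < eps -> relation1 mu al be m x) ->
  (forall x, 0 < x < eps -> relation3 mu al be m x) ->
  forall x, 0 < x < eps ->
  l x + acoef mu (S m) x * (2 * bcoef mu m x + be - 1 - INR m - x) =
  x * (Sig mu (S m) x + INR (S m) * (INR (S m) - 1 + 2 * al) / 2).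
Proof.
intros Hmu Hh Ha H1 H3 x Hx.
assert (Hda : is_delta (acoef mu m) x (acoef mu m x * (bcoef mu m x - bcoef mu (pred m) x))).
{ apply is_delta_acoef; auto. }
assert (Hdb : is_delta (bcoef mu m) x (acoef mu (S m) x - acoef mu m x)).
{ apply is_delta_bcoef; auto. }
assert (HdS : is_delta (Sig mu m) x (acoef mu m x)).
{ apply is_delta_Sig; auto. intros k Hk. apply Hh; [lia|exact Hx]. }
specialize (Ha x Hx).
assert (E := H1 x Hx). unfold relation1 in E. unfold relation3 in H3.
replace (Sig mu (S m) x) with (Sig mu m x + bcoef mu m x) by (unfold bcoef; ring).
rewrite S_INR.
set (a' := acoef mu (S m)) in *. set (a := acoef mu m) in *.
set (b := bcoef mu m) in *. set (b' := bcoef mu (pred m)) in *. set (s := Sig mu m) in *.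
clearbody a' a b b' s.
(* [D] is [relation3] differentiated; [delta_rules] computes both of its sides. Combining it
   linearly with [relation1] gives the goal. *)
eassert (D : _ = _).
{ eapply (is_delta_congr _ _ eps x _ _ Hx H3); delta_rules; lra. }
cbv beta in D.
lra.
Qed.

Lemma relation1_relation3 (mu : nat -> R -> R) (al be eps : R) (m : nat) :
  (forall k x, 0 < x < eps -> is_delta (mu k) x (mu (S k) x)) ->
  (forall x, 0 < x < eps ->
     mu 2%nat x + (be - 1) * mu 1%nat x = x * (mu 1%nat x + al * mu 0%nat x)) ->
  (forall k x, (k <= m)%nat -> 0 < x < eps -> pivot mu k x <> 0) ->
  (forall x, 0 < x < eps -> relation1 mu al be m x) /\
  (forall x, 0 < x < eps -> relation3 mu al be m x).
Proof.
intros Hmu Hode. induction m as [|m IH]; intros Hh.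
- split; intros x Hx; specialize (Hh O x (Nat.le_refl _) Hx).
  + unfold relation1, Sig. simpl. field.
  + assert (E : mu 2%nat x = x * (mu 1%nat x + al * mu 0%nat x) - (be - 1) * mu 1%nat x).
    { rewrite <- Hode by exact Hx. ring. }
    unfold relation3, bcoef, Sig, acoef, rowcoef, pivot, iter_elim, elim in *. simpl in *.
    rewrite E. field. exact Hh.
- destruct IH as [H1 H3].
  { intros k x Hk. apply Hh. lia. }
  assert (H1' : forall x, 0 < x < eps -> relation1 mu al be (S m) x).
  { intros x Hx. unfold relation1. simpl pred. rewrite S_INR.
    assert (D := derived_relation3 mu al be eps m
      (fun x => acoef mu (S m) x * (bcoef mu (S m) x - bcoef mu m x)) Hmu
      (fun k x Hk => Hh k x (Nat.le_le_succ_r _ _ Hk))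
      (fun x Hx => is_delta_acoef mu (S m) x (fun k => Hmu k x Hx) (fun k Hk => Hh k x Hk Hx))
      H1 H3 x Hx).
    cbv beta in D. rewrite S_INR in D. rewrite <- D. ring. }
  split; [exact H1'|]. intros x Hx.
  assert (E1 := H1' x Hx). assert (E3 := H3 x Hx).
  assert (Hda : is_delta (acoef mu (S m)) x (acoef mu (S m) x * (bcoef mu (S m) x - bcoef mu m x))).
  { apply (is_delta_acoef mu (S m)); auto. }
  assert (Hdb' : is_delta (bcoef mu (S m)) x (acoef mu (S (S m)) x - acoef mu (S m) x)).
  { apply is_delta_bcoef; auto. }
  assert (Hdb : is_delta (bcoef mu m) x (acoef mu (S m) x - acoef mu m x)).
  { apply is_delta_bcoef; auto. }
  assert (HdS : is_delta (Sig mu (S m)) x (acoef mu (S m) x)).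
  { apply is_delta_Sig; auto. intros k Hk. apply Hh; [lia|exact Hx]. }
  assert (Ha : acoef mu (S m) x <> 0).
  { simpl acoef. unfold Rdiv. apply Rmult_integral_contrapositive_currified.
    - apply Hh; [lia|exact Hx].
    - apply Rinv_neq_0_compat, Hh; [lia|exact Hx]. }
  unfold relation3, relation1 in *. simpl pred in *.
  assert (HS : Sig mu (S m) x = Sig mu m x + bcoef mu m x) by (unfold bcoef; ring).
  rewrite S_INR in *.
  set (a := acoef mu m) in *. set (a' := acoef mu (S m)) in *.
  set (a'' := acoef mu (S (S m))) in *.
  set (b := bcoef mu m) in *. set (b' := bcoef mu (S m)) in *.
  set (s := Sig mu m) in *. set (s' := Sig mu (S m)) in *.
  clearbody a a' a'' b b' s s'.
  eassert (D : _ = _).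
  { eapply (is_delta_congr _ _ eps x _ _ Hx H1'); delta_rules; lra. }
  cbv beta in D.
  rewrite HS in *.
  (* In the differentiated [relation1], the only terms without the factor [a'] are replaced by means
     of [relation1] itself, so [a'] cancels. The result [K] is the difference of [relation3] at
     [m + 1] and at [m]. *)
  assert (K : (b' x - b x) * (b' x + b x + be - (INR m + 1) - x) + (a'' x - a x - x) =
              b' x + b x + be - (INR m + 1) - x + x).
  { apply (Rmult_eq_reg_l (a' x)); [|exact Ha]. lra. }
  lra.
Qed.

(** Both [acoef mu (S m)] and its derivative vanish, hence so does the left side of
    [derived_relation3]; it remains to divide by [x]. *)
Lemma vanishing_pivot (mu : nat -> R -> R) (al be eps : R) (m : nat) :
  (forall k x, 0 < x < eps -> is_delta (mu k) x (mu (S k) x)) ->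
  (forall x, 0 < x < eps ->
     mu 2%nat x + (be - 1) * mu 1%nat x = x * (mu 1%nat x + al * mu 0%nat x)) ->
  (forall k x, (k <= m)%nat -> 0 < x < eps -> pivot mu k x <> 0) ->
  (forall x, 0 < x < eps -> pivot mu (S m) x = 0) ->
  forall x, 0 < x < eps ->
  Sig mu (S m) x = - (INR (S m) * (INR (S m) - 1 + 2 * al) / 2).
Proof.
intros Hmu Hode Hh H0 x Hx.
destruct (relation1_relation3 mu al be eps m Hmu Hode Hh) as [H1 H3].
assert (Ha0 : forall t, 0 < t < eps -> acoef mu (S m) t = 0).
{ intros t Ht. simpl acoef. rewrite H0 by exact Ht. unfold Rdiv. ring. }
assert (D := derived_relation3 mu al be eps m (fun _ => 0) Hmu Hh).
assert (Hd : forall t, 0 < t < eps -> is_delta (acoef mu (S m)) t 0).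
{ intros t Ht. apply (is_derive_ext_loc (fun _ => 0)); [|apply is_delta_const].
  apply (locally_interval _ t 0 eps); simpl; try lra.
  intros u Hu1 Hu2. symmetry. apply Ha0. simpl in *. lra. }
specialize (D Hd H1 H3 x Hx). rewrite Ha0 in D by exact Hx.
apply (Rmult_eq_reg_l x); lra.
Qed.

(** With [acoef mu m x] equal to [x] times the derivative of [S], the right side is, up to powers of
    [x], the product of the last two factors in the sigma form. *)
Definition relation2 (mu : nat -> R -> R) (al be : R) (m : nat) (x : R) : Prop :=
  acoef mu m x * (bcoef mu m x - x - INR m) * (bcoef mu (pred m) x - x - INR m + 1) =
  (acoef mu m x - x * (INR m + al - be)) * (acoef mu m x - Sig mu m x + INR m * (INR m - 1) / 2).

(** The difference of the two sides is conserved from [m] to [m + 1]: [relation3] eliminates [a'],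
    and the two instances of [relation1] eliminate the products containing [c] and [b']. At [m = 0]
    it is zero. *)
Lemma relation2_holds (mu : nat -> R -> R) (al be x : R) (m : nat) :
  (forall k, (k <= m)%nat -> relation1 mu al be k x) ->
  (forall k, (k < m)%nat -> relation3 mu al be k x) ->
  relation2 mu al be m x.
Proof.
induction m as [|m IH]; intros H1 H3.
- unfold relation2, Sig. simpl. field.
- assert (E1 := H1 m (Nat.le_succ_diag_r m)). assert (E1' := H1 (S m) (Nat.le_refl _)).
  assert (E3 := H3 m (Nat.lt_succ_diag_r m)).
  assert (E2 : relation2 mu al be m x).
  { apply IH; intros k Hk; [apply H1|apply H3]; lia. }
  unfold relation1, relation2, relation3 in *. simpl pred in *.
  assert (HS : Sig mu (S m) x = Sig mu m x + bcoef mu m x) by (unfold bcoef; ring).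
  rewrite HS in *. rewrite S_INR in *.
  set (a := acoef mu m x) in *. set (a' := acoef mu (S m) x) in *.
  set (b := bcoef mu m x) in *. set (b' := bcoef mu (S m) x) in *.
  set (c := bcoef mu (pred m) x) in *. set (s := Sig mu m x) in *. set (k := INR m) in *.
  clearbody a a' b b' c s k. clear IH H1 H3 HS.
  assert (Ea : a' = x * (b + al + k) - a - b * b - (be - 1) * b + k * (b + be - 1)
                    - k * (k - 1) / 2 + s) by lra.
  assert (E1s : a * (c - x - k + 1) = - a * (b + be - 1) + x * (s + k * (k - 1 + 2 * al) / 2)) by lra.
  assert (E1s' : a' * (b' - x - (k + 1)) =
    x * (s + b + (k + 1) * (k + 2 * al) / 2) - a' * (b + be)) by lra.
  replace (a * (b - x - k) * (c - x - k + 1)) with ((b - x - k) * (a * (c - x - k + 1))) in E2 by ring.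
  rewrite E1s in E2. rewrite E1s'. rewrite Ea.
  apply Rminus_diag_eq in E2. apply Rminus_diag_uniq. rewrite <- E2. field.
Qed.

(** The first relation turns the squared bracket into [(a / x) ^ 2 * (b + c - 2 * x - 2 * n + 1) ^
    2]. Subtracting [(a / x) ^ 2 * (b - c - 1) ^ 2] leaves a difference of squares, which factors as
    [4 * (a / x) ^ 2 * (b - x - n) * (c - x - n + 1)]; the second relation evaluates this
    product. *)
Lemma sigma_form_algebra (x n al be a b c s : R) :
  x <> 0 ->
  a * (b + c + be - n - x) = x * (s + n * (n - 1 + 2 * al) / 2) ->
  a * (b - x - n) * (c - x - n + 1) = (a - x * (n + al - be)) * (a - s + n * (n - 1) / 2) ->
  (a * (b - c - 1) / x) ^ 2 =
    ((x + n + be - 1) * (a / x) - s - / 2 * n * (n - 1 + 2 * al)) ^ 2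
    - 4 * (a / x) * (a / x - n - al + be) * (x * (a / x) - s + / 2 * n * (n - 1)).
Proof.
intros Hx E1 E2.
assert (Es : (x + n + be - 1) * (a / x) - s - / 2 * n * (n - 1 + 2 * al) =
  - (a / x) * (b + c - 2 * x - 2 * n + 1)).
{ apply (Rmult_eq_reg_l x); [|exact Hx]. field_simplify; [|exact Hx|exact Hx]. lra. }
rewrite Es.
replace (4 * (a / x) * (a / x - n - al + be) * (x * (a / x) - s + / 2 * n * (n - 1)))
  with (4 * a / (x * x) * ((a - x * (n + al - be)) * (a - s + n * (n - 1) / 2)))
  by (field; exact Hx).
rewrite <- E2. field. exact Hx.
Qed.

(** * Kummer's function *)

(** The last pivot may vanish. This allows a zero determinant to be traced back to a zero pivot. *)
Lemma detn_pivots (m : nat) (A : nat -> nat -> R) :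
  (forall k, (k < m)%nat -> Nat.iter k elim A O O <> 0) ->
  detn (S m) A = detn m A * Nat.iter m elim A O O.
Proof.
revert A. induction m as [|m IH]; intros A H.
- simpl. ring.
- assert (H0 : A O O <> 0) by (apply (H O); lia).
  rewrite (detn_elim (S m) A H0), (detn_elim m A H0), IH, Nat.iter_succ_r; [ring|].
  intros k Hk. rewrite <- Nat.iter_succ_r. apply H. lia.
Qed.

(** For [mu = moments a b] this is convertible to [Delta_n m a b x]. *)
Definition tau (mu : nat -> R -> R) (m : nat) (x : R) : R :=
  detn m (fun i j => mu (i + j)%nat x).

Lemma tau_S (mu : nat -> R -> R) (m : nat) (x : R) :
  (forall k, (k < m)%nat -> pivot mu k x <> 0) ->
  tau mu (S m) x = tau mu m x * pivot mu m x.
Proof. apply detn_pivots. Qed.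

Lemma tau_neq0 (mu : nat -> R -> R) (m : nat) (x : R) :
  (forall k, (k < m)%nat -> pivot mu k x <> 0) -> tau mu m x <> 0.
Proof.
induction m as [|m IH]; intros H.
- unfold tau. simpl. lra.
- rewrite tau_S by (intros k Hk; apply H; lia).
  apply Rmult_integral_contrapositive_currified.
  + apply IH. intros k Hk. apply H. lia.
  + apply H. lia.
Qed.

(** The pivots have logarithmic derivatives [bcoef], and these telescope to [Sig mu m]. *)
Lemma is_delta_tau (mu : nat -> R -> R) (eps : R) (m : nat) :
  (forall k x, 0 < x < eps -> is_delta (mu k) x (mu (S k) x)) ->
  (forall k x, (k < m)%nat -> 0 < x < eps -> pivot mu k x <> 0) ->
  forall x, 0 < x < eps -> is_delta (tau mu m) x (Sig mu m x * tau mu m x).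
Proof.
intros Hmu. induction m as [|m IH]; intros H x Hx.
- apply (is_delta_eq _ _ 0); [apply is_delta_const|]. unfold Sig. simpl. ring.
- apply (is_derive_ext_loc (fun t => tau mu m t * pivot mu m t)).
  { apply (locally_interval _ x 0 eps); simpl; try lra.
    intros t Ht1 Ht2. symmetry. apply tau_S. intros k Hk. apply H; [lia|].
    simpl in *. lra. }
  change (is_delta (fun t => tau mu m t * pivot mu m t) x (Sig mu (S m) x * tau mu (S m) x)).
  rewrite tau_S by (intros k Hk; apply H; [lia|exact Hx]).
  eapply is_delta_eq.
  + apply is_delta_mult.
    * apply IH; [|exact Hx]. intros k t Hk. apply H. lia.
    * apply is_delta_pivot; [intros k; now apply Hmu|].
      intros k Hk. apply H; [lia|exact Hx].
  + unfold bcoef. ring.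
Qed.

(** * The Kummer series, its convergence and its differential equation *)

Lemma poch_pos (a : R) (k : nat) : 0 < a -> 0 < poch a k.
Proof.
intros Ha. induction k as [|k IH]; simpl; [lra|].
apply Rmult_lt_0_compat; [exact IH|]. generalize (pos_INR k). lra.
Qed.

Lemma kummer_coef_S (a b : R) (k : nat) :
  0 < b ->
  kummer_coef a b (S k) = kummer_coef a b k * ((a + INR k) / ((b + INR k) * INR (S k))).
Proof.
intros Hb. unfold kummer_coef. rewrite fact_simpl, mult_INR. cbn [poch].
assert (0 < poch b k) by now apply poch_pos.
assert (0 < INR (S k)) by (apply lt_0_INR; lia).
assert (INR (fact k) <> 0) by apply INR_fact_neq_0.
assert (0 <= INR k) by apply pos_INR.
field. repeat split; try assumption; lra.
Qed.

Lemma kummer_CV_radius (a b : R) :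
  0 < a -> 0 < b -> CV_radius (kummer_coef a b) = p_infty.
Proof.
intros Ha Hb.
assert (Hpos : forall k, 0 < kummer_coef a b k).
{ intros k. unfold kummer_coef. apply Rdiv_lt_0_compat; [now apply poch_pos|].
  apply Rmult_lt_0_compat; [now apply poch_pos|apply lt_0_INR, lt_O_fact]. }
apply CV_radius_infinite_DAlembert.
- intros k. generalize (Hpos k). lra.
(* The bound comes from [(a + k) / (b + k) <= 1 + a / b]. *)
- apply (is_lim_seq_le_le (fun _ => 0) _ (fun k => (1 + a / b) * / INR (S k))).
  + intros k.
    assert (H0 := Hpos k). assert (H1 : 0 <= INR k) by apply pos_INR.
    assert (H2 : 0 < INR (S k)) by (apply lt_0_INR; lia).
    rewrite kummer_coef_S by exact Hb.
    replace (kummer_coef a b k * ((a + INR k) / ((b + INR k) * INR (S k))) / kummer_coef a b k)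
      with ((a + INR k) / (b + INR k) * / INR (S k)) by (field; repeat split; lra).
    assert (H3 : 0 <= (a + INR k) / (b + INR k)) by (apply Rle_mult_inv_pos; lra).
    assert (H4 : 0 < / INR (S k)) by now apply Rinv_0_lt_compat.
    rewrite Rabs_pos_eq by (apply Rmult_le_pos; lra).
    split; [apply Rmult_le_pos; lra|].
    apply Rmult_le_compat_r; [lra|].
    apply (Rmult_le_reg_r (b + INR k)); [lra|].
    unfold Rdiv at 1. rewrite Rmult_assoc, Rinv_l, Rmult_1_r by lra.
    assert (H5 : 0 < a / b) by now apply Rdiv_lt_0_compat.
    assert (H6 : a / b * b = a) by (field; lra).
    assert (H7 : 0 <= a / b * INR k) by (apply Rmult_le_pos; lra).
    lra.
  + apply is_lim_seq_const.
  + replace (Finite 0) with (Rbar_mult (1 + a / b) 0) by (simpl; f_equal; ring).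
    apply is_lim_seq_scal_l.
    apply (is_lim_seq_incr_1 (fun k => / INR k)).
    replace (Finite 0) with (Rbar_inv p_infty) by reflexivity.
    apply is_lim_seq_inv; [apply is_lim_seq_INR|easy].
Qed.

Lemma expands_KummerM (a b : R) :
  0 < a -> 0 < b -> expands (kummer_coef a b) (KummerM a b).
Proof.
intros Ha Hb. apply expands_intro. intros x.
assert (He : exists l, infinite_sum (fun k => kummer_coef a b k * x ^ k) l).
{ exists (PSeries (kummer_coef a b) x). apply is_series_Reals, is_pseries_R, PSeries_correct.
  apply CV_radius_inside. now rewrite kummer_CV_radius. }
apply is_pseries_R, is_series_Reals. unfold KummerM. now apply epsilon_spec.
Qed.

Definition moments (a b : R) (k : nat) : R -> R := Nat.iter k delta (KummerM a b).

Lemma entire_moments (a b : R) (k : nat) :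
  0 < a -> 0 < b -> entire (moments a b k).
Proof.
intros Ha Hb. induction k as [|k IH].
- eexists. now apply expands_KummerM.
- now apply entire_delta.
Qed.

Lemma entire_tau (mu : nat -> R -> R) (m : nat) :
  (forall k, entire (mu k)) -> entire (tau mu m).
Proof.
intros H. apply (entire_detn m (fun i j => mu (i + j)%nat)). intros i j. apply H.
Qed.

Lemma is_delta_delta (f : R -> R) (x : R) :
  entire f -> x <> 0 -> is_delta f x (delta f x).
Proof.
intros Hf Hx. unfold is_delta, delta.
replace (x * Deriv f x / x) with (Deriv f x) by (field; exact Hx).
now apply entire_is_derive.
Qed.

(** Since [delta] multiplies the [k]-th coefficient by [k], comparing coefficients gives the
    recursion [(k + 1) * (k + b) * c_(k+1) = (k + a) * c_k] of [kummer_coef]. *)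
Lemma kummer_equation (a b x : R) :
  0 < a -> 0 < b ->
  moments a b 2 x + (b - 1) * moments a b 1 x =
  x * (moments a b 1 x + a * moments a b 0 x).
Proof.
intros Ha Hb.
assert (H0 := expands_KummerM a b Ha Hb).
assert (H1 := expands_delta _ _ H0). assert (H2 := expands_delta _ _ H1).
assert (L := expands_plus _ _ _ _ H2 (expands_scal (b - 1) _ _ H1)).
assert (M := expands_incr _ _ (expands_plus _ _ _ _ H1 (expands_scal a _ _ H0))).
refine (eq_trans (proj2 L x) (eq_trans _ (eq_sym (proj2 M x)))). apply PSeries_ext.
intros [|k]; unfold PS_plus, PS_scal, PS_incr_1, plus, scal, zero; simpl; unfold mult; simpl.
- ring.
- change (match k with O => 1 | S _ => INR k + 1 end) with (INR (S k)).
  rewrite kummer_coef_S by exact Hb.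
  assert (0 <= INR k) by apply pos_INR. rewrite S_INR. field. lra.
Qed.

(** * Nonvanishing of the pivots to the right of 0 *)

Lemma pivots_neq0 (a b : R) (m : nat) :
  0 < a -> 0 < b ->
  exists eps : posreal, forall k x, (k <= m)%nat -> 0 < x < eps -> pivot (moments a b) k x <> 0.
Proof.
intros Ha Hb. set (mu := moments a b).
assert (Hent : forall k, entire (mu k)) by (intros k; now apply entire_moments).
assert (Hmu : forall eps k x, 0 < x < eps -> is_delta (mu k) x (mu (S k) x)).
{ intros eps k x Hx. apply (is_delta_delta (mu k)); [apply Hent|lra]. }
induction m as [|m [eps IH]].
- destruct (entire_nonzero_near_0 (mu O) 0 (Hent O)) as [eps H].
  { change (KummerM a b 0 <> 0). rewrite (proj2 (expands_KummerM a b Ha Hb)), PSeries_0.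
    unfold kummer_coef. simpl. lra. }
  exists eps. intros k x Hk. replace k with O by lia. apply H.
(* On [(0, eps)] this determinant is [pivot mu (S m)] times the nonzero [tau mu (S m)], so it
   decides whether the new pivot vanishes. *)
- destruct (classic (exists z, tau mu (S (S m)) z <> 0)) as [[z Hz]|Hz].
  + destruct (entire_nonzero_near_0 _ z (entire_tau mu (S (S m)) Hent) Hz) as [eps' H'].
    exists (mkposreal (Rmin eps eps') (Rmin_pos _ _ (cond_pos eps) (cond_pos eps'))).
    intros k x Hk [Hx1 Hx2]. simpl in Hx2.
    generalize (Rmin_l eps eps') (Rmin_r eps eps'). intros L1 L2.
    assert (Hp : forall k, (k <= m)%nat -> pivot mu k x <> 0).
    { intros j Hj. apply IH; [exact Hj|lra]. }
    destruct (Nat.eq_dec k (S m)) as [->|Hne]; [|apply Hp; lia].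
    intros E. apply (H' x); [lra|]. rewrite tau_S, E; [ring|].
    intros j Hj. apply Hp. lia.
  + exfalso.
    assert (Hp : forall x, 0 < x < eps -> pivot mu (S m) x = 0).
    { intros x Hx. assert (Hp : forall k, (k < S m)%nat -> pivot mu k x <> 0).
      { intros k Hk. apply IH; [lia|exact Hx]. }
      apply (Rmult_eq_reg_l (tau mu (S m) x)); [|now apply tau_neq0].
      rewrite <- tau_S by exact Hp. rewrite Rmult_0_r.
      apply NNPP. intros Hz'. apply Hz. now exists x. }
    (* By [vanishing_pivot], [- N] is the logarithmic derivative of [tau mu (S m)]. *)
    set (N := INR (S m) * (INR (S m) - 1 + 2 * a) / 2).
    assert (HN : 0 < N).
    { unfold N. rewrite S_INR. assert (0 <= INR m) by apply pos_INR.
      apply Rdiv_lt_0_compat; [apply Rmult_lt_0_compat; lra|lra]. }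
    set (f := tau mu (S m)). assert (Hf : entire f) by now apply entire_tau.
    assert (Hd : forall x, 0 < x < eps -> delta f x + N * f x = 0).
    { intros x Hx.
      assert (Hp' : forall k x, (k < S m)%nat -> 0 < x < eps -> pivot mu k x <> 0).
      { intros k t Hk. apply IH. lia. }
      assert (E := is_delta_unique f x _ _ (Rgt_not_eq _ _ (proj1 Hx))
        (is_delta_delta f x Hf (Rgt_not_eq _ _ (proj1 Hx)))
        (is_delta_tau mu eps (S m) (Hmu eps) Hp' x Hx)).
      rewrite E, (vanishing_pivot mu a b eps m (Hmu eps)); try assumption.
      - fold N. fold f. ring.
      - intros t _. now apply kummer_equation. }
    destruct Hf as [c Hc].
    assert (Hg := expands_plus _ _ _ _ (expands_delta _ _ Hc) (expands_scal N _ _ Hc)).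
    assert (H0 : forall x, delta f x + N * f x = 0).
    { intros x. apply (entire_eq0 (fun x => delta f x + N * f x) eps); [eexists; exact Hg|exact Hd]. }
    (* The [k]-th coefficient of [delta f + N * f] is [(k + N) * c k], and [k + N] is positive. *)
    assert (Hc0 : forall k, c k = 0).
    { intros k.
      assert (E : PS_plus (fun k => INR k * c k) (PS_scal N c) k = (fun _ => 0) k).
      { apply (PSeries_ext_recip _ (fun _ => 0)).
        - now rewrite (proj1 Hg).
        - now rewrite CV_radius_const_0.
        - apply filter_forall. intros x. rewrite PSeries_const_0, <- (proj2 Hg x). apply H0. }
      unfold PS_plus, PS_scal, plus, scal in E; simpl in E; unfold mult in E; simpl in E.
      apply (Rmult_eq_reg_l (INR k + N)); [lra|].
      generalize (pos_INR k). lra. }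
    assert (He := cond_pos eps).
    apply (tau_neq0 mu (S m) (eps / 2)).
    { intros k Hk. apply IH; [lia|lra]. }
    fold f. rewrite (proj2 Hc), (PSeries_ext c (fun _ => 0)) by exact Hc0.
    apply PSeries_const_0.
Qed.

(** * Derivatives of the logarithmic derivative with cleared denominators *)

Lemma entire_locally_neq0 (f : R -> R) (x : R) :
  entire f -> f x <> 0 -> locally x (fun t => f t <> 0).
Proof.
intros Hf Hx.
assert (Hc : continuous f x).
{ apply (ex_derive_continuous f). eexists. now apply entire_is_derive. }
apply (Hc (fun y => y <> 0)). apply (open_neq 0 (f x) Hx).
Qed.

(* For [k <= 2], [T ^ (k + 1)] times the [k]-th derivative of [delta T / T]. *)
Definition dlog_numer (T : R -> R) (k : nat) : R -> R :=
  match k with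
  | O => delta T
  | S O => fun x => T x * Deriv (delta T) x - delta T x * Deriv T x
  | _ => fun x =>
      T x * Deriv (fun y => T y * Deriv (delta T) y - delta T y * Deriv T y) x
      - 2 * (T x * Deriv (delta T) x - delta T x * Deriv T x) * Deriv T x
  end.

Lemma entire_dlog_numer (T : R -> R) (k : nat) : entire T -> entire (dlog_numer T k).
Proof.
intros HT.
assert (H0 : entire (delta T)) by now apply entire_delta.
assert (H1 : entire (fun x => T x * Deriv (delta T) x - delta T x * Deriv T x)).
{ apply entire_minus; apply entire_mult; try apply entire_Deriv; assumption. }
destruct k as [|[|k]]; simpl; [assumption|assumption|].
apply entire_minus; apply entire_mult.
- exact HT.
- now apply entire_Deriv.
- apply entire_mult; [apply entire_const|exact H1].
- now apply entire_Deriv.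
Qed.

Lemma is_derive_dlog (T : R -> R) (x : R) :
  entire T -> T x <> 0 ->
  is_derive (fun y => delta T y / T y) x (dlog_numer T 1 x / T x ^ 2).
Proof.
intros HT Hx.
replace (dlog_numer T 1 x / T x ^ 2)
  with ((Deriv (delta T) x * T x - delta T x * Deriv T x) / T x ^ 2).
- apply is_derive_div; [now apply entire_is_derive, entire_delta|now apply entire_is_derive|exact Hx].
- simpl dlog_numer. field. exact Hx.
Qed.

Lemma is_derive_Deriv_dlog (T : R -> R) (x : R) :
  entire T -> T x <> 0 ->
  is_derive (Deriv (fun y => delta T y / T y)) x (dlog_numer T 2 x / T x ^ 3).
Proof.
intros HT Hx.
apply (is_derive_ext_loc (fun y => dlog_numer T 1 y / T y ^ 2)).
{ generalize (entire_locally_neq0 T x HT Hx). apply filter_imp. intros y Hy.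
  symmetry. apply Deriv_unique. now apply is_derive_dlog. }
replace (dlog_numer T 2 x / T x ^ 3)
  with ((Deriv (dlog_numer T 1) x * T x ^ 2 - dlog_numer T 1 x * (2 * T x * Deriv T x)) / (T x ^ 2) ^ 2).
- apply is_derive_div.
  + now apply entire_is_derive, entire_dlog_numer.
  + replace (2 * T x * Deriv T x) with (INR 2 * Deriv T x * T x ^ 1) by (simpl; ring).
    apply (is_derive_pow T 2). now apply entire_is_derive.
  + now apply pow_nonzero.
- simpl dlog_numer. field. exact Hx.
Qed.

(** * The sigma form near 0 and its continuation to the whole line *)

Theorem theorem5p4 (alpha beta : R) (n : nat) (z : R)
  (halpha : 0 < alpha) (hbeta : 0 < beta) (hn : (1 <= n)%nat)
  (hz : Delta_n n alpha beta z <> 0) :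
  let S := Sn n alpha beta in
  let S1 := Deriv S z in
  let S2 := Deriv (Deriv S) z in
  let nR := INR n in
  (z * S2) ^ 2 =
    ((z + nR + beta - 1) * S1 - S z - / 2 * nR * (nR - 1 + 2 * alpha)) ^ 2
    - 4 * S1 * (S1 - nR - alpha + beta) * (z * S1 - S z + / 2 * nR * (nR - 1)).
Proof.
intros S S1 S2 nR.
set (mu := moments alpha beta).
assert (Hent : forall k, entire (mu k)) by (intros k; now apply entire_moments).
set (T := tau mu n). assert (HT : entire T) by now apply entire_tau.
assert (HD1 : forall x, T x <> 0 -> Deriv S x = dlog_numer T 1 x / T x ^ 2).
{ intros x Hx. apply Deriv_unique. now apply (is_derive_dlog T). }
assert (HD2 : forall x, T x <> 0 -> Deriv (Deriv S) x = dlog_numer T 2 x / T x ^ 3).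
{ intros x Hx. apply Deriv_unique. now apply (is_derive_Deriv_dlog T). }
(* [T ^ 6] times the difference of the two sides: the second derivative of [S] has denominator
   [T ^ 3] and enters squared. Unlike [S], this function is entire across the zeros of [T]. *)
pose (defect := fun x => (x * dlog_numer T 2 x) ^ 2 -
  (((x + (nR + beta - 1)) * dlog_numer T 1 x * T x - dlog_numer T 0 x * T x ^ 2
     - / 2 * nR * (nR - 1 + 2 * alpha) * T x ^ 3) ^ 2
   - 4 * dlog_numer T 1 x * (dlog_numer T 1 x - (nR + alpha - beta) * T x ^ 2) *
     (x * dlog_numer T 1 x - dlog_numer T 0 x * T x + / 2 * nR * (nR - 1) * T x ^ 2))).
assert (Hdefect : forall x, T x <> 0 -> defect x = T x ^ 6 *
  ((x * Deriv (Deriv S) x) ^ 2 -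
   (((x + nR + beta - 1) * Deriv S x - S x - / 2 * nR * (nR - 1 + 2 * alpha)) ^ 2
    - 4 * Deriv S x * (Deriv S x - nR - alpha + beta) * (x * Deriv S x - S x + / 2 * nR * (nR - 1))))).
{ intros x Hx. rewrite HD1, HD2 by exact Hx.
  change (S x) with (dlog_numer T 0 x / T x). unfold defect. field. exact Hx. }
enough (Hz : defect z = 0).
{ rewrite (Hdefect z hz) in Hz. apply Rminus_diag_uniq.
  apply (Rmult_eq_reg_l (T z ^ 6)); [|now apply pow_nonzero].
  rewrite Rmult_0_r. exact Hz. }
(* Index [n] is included, one beyond the factors of [T], because [bcoef mu n] divides by
   [pivot mu n]. *)
destruct (pivots_neq0 alpha beta n halpha hbeta) as [eps Hp].
fold mu in Hp.
assert (Hdefent : entire defect).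
{ assert (HN := fun k => entire_dlog_numer T k HT).
  unfold defect.
  repeat first
    [ assumption | apply HN | apply entire_const | apply entire_id
    | apply entire_minus | apply entire_plus | apply entire_mult | apply entire_pow ]. }
apply (entire_eq0 defect eps z Hdefent). intros x Hx.
assert (Hmu : forall k x, 0 < x < eps -> is_delta (mu k) x (mu (Datatypes.S k) x)).
{ intros k t Ht. apply (is_delta_delta (mu k)); [apply Hent|lra]. }
assert (HTx : forall t, 0 < t < eps -> T t <> 0).
{ intros t Ht. apply tau_neq0. intros k Hk. apply Hp; [lia|exact Ht]. }
assert (HS : forall t, 0 < t < eps -> S t = Sig mu n t).
{ intros t Ht. change (S t) with (delta T t / T t).
  assert (E : delta T t = Sig mu n t * T t).
  { apply (is_delta_unique T t); [lra|apply is_delta_delta; [exact HT|lra]|].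
    apply (is_delta_tau mu eps); [exact Hmu| |exact Ht].
    intros k u Hk. apply Hp. lia. }
  rewrite E. field. now apply HTx. }
assert (Hloc : forall t, 0 < t < eps -> locally t (fun u => 0 < u < eps)).
{ intros t Ht. apply (locally_interval _ t 0 eps); simpl; try lra.
  intros u Hu1 Hu2. simpl in *. lra. }
assert (HS1 : forall t, 0 < t < eps -> Deriv S t = acoef mu n t / t).
{ intros t Ht. apply Deriv_unique. apply (is_derive_ext_loc (Sig mu n)).
  - generalize (Hloc t Ht). apply filter_imp. intros u Hu. symmetry. now apply HS.
  - apply is_delta_Sig; [intros k; now apply Hmu|]. intros k Hk. apply Hp; [lia|exact Ht]. }
(* The [- 1] comes from the denominator [t] in [acoef mu n t / t]; the final [/ x] passes from
   [delta] to the ordinary derivative. *)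
assert (HS2 : Deriv (Deriv S) x =
  acoef mu n x * (bcoef mu n x - bcoef mu (pred n) x - 1) / x / x).
{ apply Deriv_unique. apply (is_derive_ext_loc (fun t => acoef mu n t / t)).
  - generalize (Hloc x Hx). apply filter_imp. intros u Hu. symmetry. now apply HS1.
  - change (is_delta (fun t => acoef mu n t / t) x
      (acoef mu n x * (bcoef mu n x - bcoef mu (pred n) x - 1) / x)).
    eapply is_delta_eq.
    + apply is_delta_div; [lra| |apply is_delta_id; lra].
      apply is_delta_acoef; [intros k; now apply Hmu|]. intros k Hk. now apply Hp.
    + cbv beta. field. lra. }
rewrite (Hdefect x (HTx x Hx)), HS2, (HS x Hx), (HS1 x Hx).
assert (Hrel : forall k, (k <= n)%nat -> relation1 mu alpha beta k x /\ relation3 mu alpha beta k x).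
{ intros k Hk. destruct (relation1_relation3 mu alpha beta eps k Hmu) as [H1 H3].
  - intros t _. now apply kummer_equation.
  - intros j t Hj. apply Hp. lia.
  - split; [now apply H1|now apply H3]. }
assert (E := sigma_form_algebra x nR alpha beta (acoef mu n x) (bcoef mu n x)
  (bcoef mu (pred n) x) (Sig mu n x)).
rewrite <- E.
- field. lra.
- lra.
- now apply Hrel.
- apply (relation2_holds mu alpha beta x n); intros k Hk; apply Hrel; lia.
Qed.
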